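(* Let $n\ge1$, let $(E,\rho,[-,-])$ be a Lie algebroid over a smooth manifold $M$, and let $J\in\Gamma(\wedge^nE^* )$ and $\omega\in\Omega^{n+1}(M)$ satisfy ${}^E\mathrm{d}J=-\iota_\rho^{n+1}\omega$. Then the subbundle $L\subset E\oplus\wedge^{n-1}E^*$ with $$\Gamma(L)=\{u+\iota_uJ\ :\ u\in\Gamma(E)\}$$ is a higher Dirac structure of the Lie $n$-algebroid $E\oplus\wedge^{n-1}E^*$ (with the $\omega$-twisted Dorfman bracket).
   Context: A Lie algebroid $(E,\rho,[-,-])$ is a vector bundle with anchor $\rho:E\to TM$ and a Lie bracket on $\Gamma(E)$ with $[e_1,fe_2]=f[e_1,e_2]+(\rho(e_1)f)e_2$. Its differential is $${}^E\mathrm{d}\alpha(e_1,\dots,e_{m+1})=\sum_i(-1)^{i-1}\rho(e_i)\alpha(\dots,\check e_i,\dots)+\sum_{i<j}(-1)^{i+j}\alpha([e_i,e_j],\dots,\check e_i,\dots,\check e_j,\dots).$$ $\iota_u$ is the interior product on $\Gamma(\wedge^\bullet E^* )$ by $u\in\Gamma(E)$ (contraction in the first slot), and ${}^E\mathcal L_u=\iota_u\,{}^E\mathrm{d}+{}^E\mathrm{d}\,\iota_u$. $\iota_\rho^{n+1}\omega\in\Gamma(\wedge^{n+1}E^* )$ is $\iota_\rho^{n+1}\omega(e_1,\dots,e_{n+1})=\omega(\rho(e_{n+1}),\dots,\rho(e_1))$. The Lie $n$-algebroid structure on $E\oplus\wedge^{n-1}E^*$ consists of the following operations, for $u,v\in\Gamma(E)$,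 $\alpha,\beta\in\Gamma(\wedge^{n-1}E^* )$ and $f\in C^\infty(M)$: - the symmetric pairing $(u+\alpha,v+\beta)=\iota_u\beta+\iota_v\alpha\in\Gamma(\wedge^{n-2}E^* )$ (zero if $n=1$); - the anchor $\hat\rho(u+\alpha)f=\rho(u)f$; - the Dorfman bracket $[u+\alpha,v+\beta]_D=[u,v]+{}^E\mathcal L_u\beta-\iota_v\,{}^E\mathrm{d}\alpha+\iota_v\iota_u(\iota_\rho^{n+1}\omega)$. A higher Dirac structure is a subbundle $L$ such that $(e_1,e_2)=0$ and $[e_1,e_2]_D\in\Gamma(L)$ for all $e_1,e_2\in\Gamma(L)$ (no maximality of rank is required). *)

(* Defs.v *)
From HB Require Import structures.
From mathcomp Require Import all_boot all_order all_algebra.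
From mathcomp Require Import all_classical all_reals all_analysis.

Set Implicit Arguments.
Unset Strict Implicit.
Unset Printing Implicit Defensive.

Import Order.TTheory GRing.Theory Num.Theory.
Import numFieldNormedType.Exports.
Local Open Scope classical_set_scope.
Local Open Scope ring_scope.

Section smooth_rV.
Context {R : realType} {m : nat}.
Implicit Types (U W : set 'rV[R]_m) (f g : 'rV[R]_m -> R).

Lemma differentiable_near (V : normedModType R) (f g : 'rV[R]_m -> V) x :
  (\near x, f x = g x) -> differentiable f x -> differentiable g x.
Proof.
move=> fg df.
have -> : g = f + (g - f) by rewrite addrC subrK.
apply: differentiableD => //.
set k := g - f.
have k0 : \near x, k x = 0.
  by near=> y; rewrite /k !fctE; apply/subr0_eq; rewrite subr0;
     apply/eqP; rewrite subr_eq0; apply/eqP/esym; near: y.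
have E : k \o shift x = cst (k x) + \0 +o_ (0 : 'rV[R]_m) id.
  apply: eqaddoE; rewrite (nbhs_singleton k0).
  have -> : cst 0 + \0 = 0 :> ('rV[R]_m -> V) by rewrite addr0.
  rewrite add0r; apply/eqoP => e e0.
  have := k0; rewrite (near_shift 0) subr0 => H.
  near=> h.
  have -> : (k \o shift x) h = 0 by near: h.
  by rewrite normr0 mulr_ge0// ltW.
apply/diff_locallyP.
have c0 : continuous (\0 : 'rV[R]_m -> V) by exact: cst_continuous.
have -> : 'd k x = (\0 : 'rV[R]_m -> V) :> ('rV[R]_m -> V).
  by apply: (@diff_unique _ _ _ k (\0%R)).
by [].
Unshelve. all: by end_near. Qed.

(* C^k on an open set U: differentiable with C^(k-1) directional derivatives.
   The values of f outside U are irrelevant. *)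
Fixpoint Ck (k : nat) U f : Prop :=
  match k with
  | 0%N => forall x, U x -> {for x, continuous f}
  | k'.+1 => (forall x, U x -> differentiable f x) /\
             (forall v, Ck k' U (fun x => 'D_v f x))
  end.

Definition smooth U f : Prop := forall k, Ck k U f.

Lemma open_near U x f g : open U -> (forall x, U x -> f x = g x) -> U x ->
  \near x, f x = g x.
Proof. by move=> oU fg Ux; apply: filterS fg _; exact: open_nbhs_nbhs. Qed.

Lemma Ck_ext k U f g : open U -> (forall x, U x -> f x = g x) ->
  Ck k U f -> Ck k U g.
Proof.
move=> oU; elim: k f g => [|k IH] f g fg /=.
  move=> cf x Ux; suff: g @ x --> g x by []; rewrite -(fg x Ux).
  apply: (cvg_trans _ (cf x Ux : f @ x --> f x)).
  exact: (@near_eq_cvg _ _ (nbhs x) _ f g (open_near oU fg Ux)).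
move=> [df cf]; split=> [x Ux|v].
  exact: differentiable_near (open_near oU fg Ux) (df x Ux).
apply: IH (cf v) => x Ux.
exact: near_eq_derive (open_near oU fg Ux).
Qed.

Lemma CkS k U f : Ck k.+1 U f -> Ck k U f.
Proof.
elim: k f => [|k IH] f /= [df cf].
  by move=> x /df; exact: differentiable_continuous.
by split=> // v; apply: IH; exact: cf.
Qed.

Lemma Ck_sub k U W f : U `<=` W -> Ck k W f -> Ck k U f.
Proof.
move=> UW; elim: k f => [|k IH] f /=; first by move=> cf x /UW /cf.
by move=> [df cf]; split=> [x /UW /df//|v]; exact: IH.
Qed.

Lemma Ck_bigcup (I : Type) k (W : I -> set 'rV[R]_m) f :
  (forall i, Ck k (W i) f) -> Ck k (\bigcup_i W i) f.
Proof.
elim: k f => [|k IH] f /= H; first by move=> x [i _ /H].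
by split=> [x [i _ /((H i).1 x)]//|v]; apply: IH => i; exact: (H i).2.
Qed.

Lemma Ck_cst k U (a : R) : Ck k U (fun=> a).
Proof.
elim: k a => [|k IH] a /=; first by move=> x _; exact: (@cst_continuous _ _ a x).
split=> [x _|v]; first exact: differentiable_cst.
have -> : (fun x : 'rV[R]_m => 'D_v (fun=> a) x) = fun=> 0; last exact: IH.
by apply/funext => x; exact: derive_cst.
Qed.

Lemma CkD k U f g : open U -> Ck k U f -> Ck k U g -> Ck k U (fun x => f x + g x).
Proof.
move=> oU; elim: k f g => [|k IH] f g /=.
  by move=> cf cg x Ux; exact: (@continuousD _ _ _ f g x (cf x Ux) (cg x Ux)).
move=> [df cf] [dg cg]; split=> [x Ux|v].
  by apply: (@differentiableD _ _ _ f g); [exact: df|exact: dg].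
apply: (Ck_ext oU) (IH _ _ (cf v) (cg v)) => x Ux.
by rewrite -deriveD//; apply: diff_derivable; [exact: df|exact: dg].
Qed.

Lemma CkM k U f g : open U -> Ck k U f -> Ck k U g -> Ck k U (fun x => f x * g x).
Proof.
move=> oU; elim: k f g => [|k IH] f g.
  by move=> /= cf cg x Ux; exact: (@continuousM _ _ f g x (cf x Ux) (cg x Ux)).
move=> cf cg; have [df /= cf'] := cf; have [dg /= cg'] := cg; split=> [x Ux|v].
  by apply: (@differentiableM _ _ f g); [exact: df|exact: dg].
have H := CkD oU (IH _ _ (CkS cf) (cg' v)) (IH _ _ (CkS cg) (cf' v)).
apply: (Ck_ext oU) H => x Ux.
by rewrite [RHS]deriveM//; apply: diff_derivable; [exact: df|exact: dg].
Qed.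

Lemma Ck_sum (I : Type) (s : seq I) k U (F : I -> 'rV[R]_m -> R) : open U ->
  (forall i, Ck k U (F i)) -> Ck k U (fun x => \sum_(i <- s) F i x).
Proof.
move=> oU H; elim: s => [|i s IH].
  by apply: (Ck_ext oU) (Ck_cst k U 0) => x _; rewrite big_nil.
by apply: (Ck_ext oU) (CkD oU (H i) IH) => x _; rewrite big_cons.
Qed.

Lemma smooth_ext U f g : open U -> (forall x, U x -> f x = g x) ->
  smooth U f -> smooth U g.
Proof. by move=> oU fg H k; exact: Ck_ext (H k). Qed.

End smooth_rV.

Section smooth_comp.
Context {R : realType} {m p : nat}.

Lemma differentiable_rV (T : 'rV[R]_m -> 'rV[R]_p) x :
  (forall j, differentiable (fun z => T z ord0 j) x) -> differentiable T x.
Proof.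
move=> H.
have -> : T = \sum_j (fun z => T z ord0 j *: delta_mx ord0 j).
  by apply/funext => z; rewrite fct_sumE -row_sum_delta.
by apply: differentiable_sum => j; apply: differentiableZl.
Qed.

Lemma derive_rV (T : 'rV[R]_m -> 'rV[R]_p) x v j : differentiable T x ->
  'D_v T x ord0 j = 'D_v (fun z => T z ord0 j) x.
Proof. by move=> dT; rewrite derive_mx ?mxE//; exact: diff_derivable. Qed.

Lemma derive_sum_delta (f : 'rV[R]_p -> R) x v : differentiable f x ->
  'D_v f x = \sum_j v ord0 j * 'D_(delta_mx ord0 j) f x.
Proof.
move=> df; rewrite deriveE// {1}(row_sum_delta v) linear_sum.
by apply: eq_bigr => j _; rewrite linearZ deriveE.
Qed.

Lemma derive_comp_rV (f : 'rV[R]_p -> R) (T : 'rV[R]_m -> 'rV[R]_p) x v :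
  differentiable T x -> differentiable f (T x) ->
  'D_v (f \o T) x = 'D_('d T x v) f (T x).
Proof.
move=> dT df; rewrite !deriveE//; last exact: differentiable_comp.
by rewrite diff_comp.
Qed.

Lemma Ck_comp k (U : set 'rV[R]_m) (W : set 'rV[R]_p) (f : 'rV[R]_p -> R)
    (T : 'rV[R]_m -> 'rV[R]_p) : open U -> open W ->
  (forall x, U x -> W (T x)) ->
  (forall j, Ck k.+1 U (fun x => T x ord0 j)) -> Ck k W f ->
  Ck k U (fun x => f (T x)).
Proof.
move=> oU oW UW; elim: k f => [|k IH] f /= cT.
  move=> cf x Ux; apply: (@continuous_comp _ _ _ T f); last exact/cf/UW.
  by apply/differentiable_continuous/differentiable_rV => j; case: (cT j) => + _; apply.
have dT x : U x -> differentiable T x.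
  by move=> Ux; apply: differentiable_rV => j; case: (cT j) => + _; apply.
move=> [df cf]; split=> [x Ux|v].
  by apply: (@differentiable_comp _ _ _ _ T f); [exact: dT|exact/df/UW].
have H : Ck k U (fun x => \sum_j 'D_v (fun z => T z ord0 j) x *
                              'D_(delta_mx ord0 j) f (T x)).
  apply: Ck_sum => // j; apply: CkM => //.
    by apply: CkS; case: (cT j) => _ /(_ v).
  apply: (IH (fun y => 'D_(delta_mx ord0 j) f y) _ (cf _)) => i.
  exact: (@CkS _ _ k.+1 U (fun x => T x ord0 i) (cT i)).
apply: (Ck_ext oU) H => x Ux.
have dfT := df _ (UW _ Ux).
rewrite [RHS](@derive_comp_rV f T x v (dT _ Ux) dfT) (derive_sum_delta _ dfT).
by apply: eq_bigr => j _; rewrite -(derive_rV v j (dT _ Ux)) (deriveE v (dT _ Ux)).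
Qed.

End smooth_comp.

(* cmap and cinv are total; only their values on cdom and cmap @` cdom matter. *)
Record chart (R : realType) (m : nat) (T : topologicalType) := Chart {
  cdom : set T;
  cmap : T -> 'rV[R]_m;
  cinv : 'rV[R]_m -> T;
  cdom_open : open cdom;
  cimg_open : open (cmap @` cdom);
  cmapK : forall x, cdom x -> cinv (cmap x) = x;
  cmap_continuous : forall x, cdom x -> {for x, continuous cmap};
  cinv_continuous : forall x, cdom x -> {for cmap x, continuous cinv} }.

(* The atlas need not be maximal: it determines the smooth structure. *)
Record manifold (R : realType) (m : nat) := Manifold {
  mspace :> topologicalType;
  mspace_hausdorff : hausdorff_space mspace;
  mspace_second_countable : @second_countable mspace;
  atlas : set (chart R m mspace);
  atlas_cover : forall x, exists2 c, atlas c & cdom c x;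
  atlas_compat : forall c c', atlas c -> atlas c' ->
    forall j, smooth (cmap c @` (cdom c `&` cdom c'))
                     (fun z => cmap c' (cinv c z) ord0 j) }.

Section smooth_functions.
Context {R : realType} {m : nat} (M : manifold R m).
Implicit Types (U W : set M) (f g : M -> R).

Definition msmooth U f : Prop := forall c, atlas c ->
  smooth (cmap c @` (U `&` cdom c)) (fun z => f (cinv c z)).

Lemma cimg_openI (c : chart R m M) U : open U -> open (cmap c @` (U `&` cdom c)).
Proof.
move=> oU; rewrite openE => z [x [Ux cx] <-].
have H1 : \forall z \near cmap c x, U (cinv c z).
  apply: (cinv_continuous cx); rewrite cmapK//; exact: open_nbhs_nbhs.
have H2 : \forall z \near cmap c x, (cmap c @` cdom c) z.
  by apply: open_nbhs_nbhs; split; [exact: cimg_open|exists x].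
near=> z'.
have [y cy yz] : (cmap c @` cdom c) z' by near: z'.
exists y => //; split=> //; rewrite -(cmapK cy) yz; near: z'; exact: H1.
Unshelve. all: by end_near. Qed.

Lemma msmooth_ext U f g : open U -> (forall x, U x -> f x = g x) ->
  msmooth U f -> msmooth U g.
Proof.
move=> oU fg sf c ac; apply: smooth_ext (sf c ac); first exact: cimg_openI.
by move=> _ [x [Ux cx] <-]; rewrite cmapK// fg.
Qed.

Lemma msmooth_sub U W f : U `<=` W -> msmooth W f -> msmooth U f.
Proof.
move=> UW sf c ac k; apply: Ck_sub (sf c ac k).
by apply: image_subset => x [/UW Wx cx].
Qed.

Lemma msmooth_bigcup (I : Type) (W : I -> set M) f :
  (forall i, msmooth (W i) f) -> msmooth (\bigcup_i W i) f.
Proof.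
move=> H c ac k; apply: (Ck_sub (W := \bigcup_i (cmap c @` (W i `&` cdom c)))).
  by move=> _ [x [[i _ Wx] cx] <-]; exists i => //; exists x.
by apply: Ck_bigcup => i; exact: H.
Qed.

Lemma msmooth_cst U (a : R) : msmooth U (fun=> a).
Proof. by move=> c ac k; exact: Ck_cst. Qed.

Lemma msmoothD U f g : open U -> msmooth U f -> msmooth U g ->
  msmooth U (fun x => f x + g x).
Proof.
by move=> oU sf sg c ac k; apply: CkD; [exact: cimg_openI|exact: sf|exact: sg].
Qed.

Lemma msmoothM U f g : open U -> msmooth U f -> msmooth U g ->
  msmooth U (fun x => f x * g x).
Proof.
by move=> oU sf sg c ac k; apply: CkM; [exact: cimg_openI|exact: sf|exact: sg].
Qed.

Lemma msmoothN U f : open U -> msmooth U f -> msmooth U (fun x => - f x).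
Proof.
move=> oU sf; apply: msmooth_ext (msmoothM oU (msmooth_cst U (-1)) sf) => //.
by move=> x _; rewrite mulN1r.
Qed.

Lemma msmooth_sum (I : Type) (s : seq I) U (F : I -> M -> R) : open U ->
  (forall i, msmooth U (F i)) -> msmooth U (fun x => \sum_(i <- s) F i x).
Proof.
by move=> oU H c ac k; apply: Ck_sum => [|i]; [exact: cimg_openI|exact: H].
Qed.

Definition smooth_fun_pred : {pred M -> R} := fun f => `[< msmooth setT f >].

Record smooth_fun := SmoothFun {
  smooth_fun_val :> M -> R;
  smooth_funP : smooth_fun_val \in smooth_fun_pred }.

HB.instance Definition _ := [isSub of smooth_fun for smooth_fun_val].
HB.instance Definition _ := [Choice of smooth_fun by <:].

Fact smooth_fun_subring : subring_closed smooth_fun_pred.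
Proof.
split; first exact/asboolP/msmooth_cst.
- move=> f g /asboolP sf /asboolP sg; apply/asboolP.
  apply: (@msmoothD setT f (fun x => - g x)) => //; first exact: openT.
  by apply: msmoothN => //; exact: openT.
- move=> f g /asboolP sf /asboolP sg; apply/asboolP.
  by apply: msmoothM => //; exact: openT.
Qed.

HB.instance Definition _ :=
  GRing.isSubringClosed.Build (M -> R) smooth_fun_pred smooth_fun_subring.
HB.instance Definition _ := 
  GRing.SubChoice_isSubComPzRing.Build _ _ smooth_fun (subringClosedP _).

Lemma smooth_fun_msmooth (f : smooth_fun) : msmooth setT f.
Proof. by case: f => f /= /asboolP. Qed.

Definition mk_smooth_fun (f : M -> R) (sf : msmooth setT f) : smooth_fun :=
  SmoothFun (introT (asboolP _) sf : f \in smooth_fun_pred).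

Definition cst_fun (a : R) : smooth_fun := mk_smooth_fun (msmooth_cst setT a).

End smooth_functions.

(* A local trivialization, given fibrewise: tcoord x is a linear isomorphism onto
   R^r with inverse tframe x for x in tdom (and arbitrary elsewhere). *)
Record trivialization (R : realType) (m : nat) (M : manifold R m)
    (F : M -> lmodType R) (r : nat) := Trivialization {
  tdom : set M;
  tcoord : forall x, {linear F x -> 'rV[R]_r};
  tframe : forall x, 'rV[R]_r -> F x;
  tdom_open : open tdom;
  tcoordK : forall x, tdom x -> cancel (tcoord x) (tframe x);
  tframeK : forall x, tdom x -> cancel (tframe x) (tcoord x) }.

(* A vector bundle of rank r presented by its fibres and a bundle atlas with smooth
   transition matrices, which determine the manifold structure of the total
   space. *)
Record vbundle (R : realType) (m : nat) (M : manifold R m) (r : nat) := VBundle {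
  fiber :> M -> lmodType R;
  vatlas : set (trivialization fiber r);
  vatlas_cover : forall x, exists2 t, vatlas t & tdom t x;
  vatlas_compat : forall t t', vatlas t -> vatlas t' -> forall i j,
    msmooth (tdom t `&` tdom t')
      (fun x => tcoord t' x (tframe t x (delta_mx ord0 i)) ord0 j) }.

Section sections.
Context {R : realType} {m : nat} {M : manifold R m} {r : nat} (E : vbundle M r).
Implicit Types (U W : set M).

Definition frame_vec (t : trivialization E r) (i : 'I_r) (x : M) : E x :=
  tframe t x (delta_mx ord0 i).

Definition section_smooth U (s : forall x, E x) : Prop := forall t, vatlas t ->
  forall j, msmooth (U `&` tdom t) (fun x => tcoord t x (s x) ord0 j).

Record section := Section_ {
  section_val :> forall x, E x;
  section_smoothP : section_smooth setT section_val }.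

Lemma section_eq (s t : section) : (forall x, s x = t x) -> s = t.
Proof.
case: s t => [s ps] [t pt] /= st.
have E0 : s = t by exact: functional_extensionality_dep.
by rewrite E0 in ps *; congr Section_; exact: Prop_irrelevance.
Qed.

HB.instance Definition _ := gen_eqMixin section.
HB.instance Definition _ := gen_choiceMixin section.

Lemma openIT (U : set M) : open U -> open (setT `&` U).
Proof. by rewrite setTI. Qed.

Fact section0_subproof : section_smooth setT (fun x => 0 : E x).
Proof.
move=> t at_ j; apply: msmooth_ext (msmooth_cst _ 0).
  by apply: openIT; exact: tdom_open.
by move=> x _; rewrite linear0 mxE.
Qed.
Definition section0 := Section_ section0_subproof.

Fact sectionD_subproof (s t : section) : section_smooth setT (fun x => s x + t x).
Proof.
move=> c ac j; have oc := openIT (tdom_open c).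
apply: msmooth_ext (msmoothD oc (section_smoothP s ac j) (section_smoothP t ac j)) => //.
by move=> x _; rewrite linearD mxE.
Qed.
Definition sectionD s t := Section_ (sectionD_subproof s t).

Fact sectionZ_subproof (f : smooth_fun M) (s : section) :
  section_smooth setT (fun x => f x *: s x).
Proof.
move=> c ac j; have oc := openIT (tdom_open c).
apply: msmooth_ext (msmoothM oc (msmooth_sub (@subsetT _ _) (smooth_fun_msmooth f)) (section_smoothP s ac j)) => //.
by move=> x _; rewrite linearZ mxE.
Qed.
Definition sectionZ f s := Section_ (sectionZ_subproof f s).

Fact sectionN_subproof (s : section) : section_smooth setT (fun x => - s x).
Proof.
move=> c ac j; have oc := openIT (tdom_open c).
apply: msmooth_ext (msmoothN oc (section_smoothP s ac j)) => //.
by move=> x _; rewrite linearN mxE.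
Qed.
Definition sectionN s := Section_ (sectionN_subproof s).

Fact sectionA : associative sectionD.
Proof. by move=> s t u; apply: section_eq => x /=; rewrite addrA. Qed.
Fact sectionC : commutative sectionD.
Proof. by move=> s t; apply: section_eq => x /=; rewrite addrC. Qed.
Fact section0D : left_id section0 sectionD.
Proof. by move=> s; apply: section_eq => x /=; rewrite add0r. Qed.
Fact sectionND : left_inverse section0 sectionN sectionD.
Proof. by move=> s; apply: section_eq => x /=; rewrite addNr. Qed.
HB.instance Definition _ :=
  GRing.isZmodule.Build section sectionA sectionC section0D sectionND.

Fact sectionZA f g s : sectionZ f (sectionZ g s) = sectionZ (f * g) s.
Proof. by apply: section_eq => x /=; rewrite scalerA. Qed.
Fact section1Z : left_id 1 sectionZ.
Proof. by move=> s; apply: section_eq => x /=; rewrite scale1r. Qed.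
Fact sectionZDr : right_distributive sectionZ +%R.
Proof. by move=> f s t; apply: section_eq => x /=; rewrite scalerDr. Qed.
Fact sectionZDl s : {morph sectionZ^~ s : f g / f + g}.
Proof. by move=> f g; apply: section_eq => x /=; rewrite scalerDl. Qed.
HB.instance Definition _ := GRing.Zmodule_isLmodule.Build (smooth_fun M) section
  sectionZA section1Z sectionZDr sectionZDl.

End sections.

Section tangent_bundle.
Context {R : realType} {m : nat} (M : manifold R m).

Definition transition (c c' : chart R m M) : 'rV[R]_m -> 'rV[R]_m :=
  fun z => cmap c' (cinv c z).

(* A tangent vector at p is its family of components in all the charts around p,
   related by the differentials of the transition maps; the components in charts
   not containing p (or not in the atlas) are set to 0. *)
Definition tangent_pred (p : M) : {pred chart R m M -> 'rV[R]_m} := fun v =>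
  `[< (forall c, ~ (atlas c /\ cdom c p) -> v c = 0) /\
      (forall c c', atlas c -> cdom c p -> atlas c' -> cdom c' p ->
         v c' = 'd (transition c c') (cmap c p) (v c)) >].

Record tangent (p : M) := Tangent {
  tangent_val :> chart R m M -> 'rV[R]_m;
  tangentP : tangent_val \in tangent_pred p }.

Section tangent_space.
Variable p : M.
HB.instance Definition _ := [isSub of tangent p for @tangent_val p].
HB.instance Definition _ := [Choice of tangent p by <:].

Fact tangent_submod : submod_closed (tangent_pred p).
Proof.
split.
  by apply/asboolP; split=> [//|c c' _ _ _ _]; rewrite linear0.
move=> a u v /asboolP [u0 uT] /asboolP [v0 vT]; apply/asboolP; split.
  by move=> c nc; rewrite !fctE u0// v0// scaler0 addr0.
move=> c c' ac cp ac' cp'.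
by rewrite !fctE (uT c c')// (vT c c')// linearP.
Qed.
HB.instance Definition _ := GRing.isSubmodClosed.Build R
  (chart R m M -> 'rV[R]_m) (tangent_pred p) tangent_submod.
HB.instance Definition _ := [SubChoice_isSubLmodule of tangent p by <:].

Definition tangent_coord (c : chart R m M) (v : tangent p) : 'rV[R]_m := v c.
Fact tangent_coord_linear c : linear (tangent_coord c).
Proof. by []. Qed.
HB.instance Definition _ c := GRing.isLinear.Build R (tangent p) 'rV[R]_m _
  (tangent_coord c) (tangent_coord_linear c).

Lemma differentiable_transition (c c' : chart R m M) : atlas c -> cdom c p ->
  atlas c' -> cdom c' p -> differentiable (transition c c') (cmap c p).
Proof.
move=> ac cp ac' cp'; apply: differentiable_rV => j.
by have [d _] := atlas_compat ac ac' j 1%N; apply: d; exists p.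
Qed.

Lemma near_cmap (c : chart R m M) (U : set M) : open U -> U p -> cdom c p ->
  \forall z \near cmap c p, cdom c (cinv c z) /\ U (cinv c z) /\ cmap c (cinv c z) = z.
Proof.
move=> oU Up cp.
have : \forall z \near cmap c p, (cmap c @` (U `&` cdom c)) z.
  by apply: open_nbhs_nbhs; split; [exact: cimg_openI|exists p].
by apply: filterS => _ [x [Ux cx] <-]; rewrite cmapK.
Qed.

Lemma transitionC (c c' c'' : chart R m M) (w : 'rV[R]_m) :
  atlas c -> cdom c p -> atlas c' -> cdom c' p -> atlas c'' -> cdom c'' p ->
  'd (transition c' c'') (cmap c' p) ('d (transition c c') (cmap c p) w) =
  'd (transition c c'') (cmap c p) w.
Proof.
move=> ac cp ac' cp' ac'' cp''.
have T1 := differentiable_transition ac cp ac' cp'.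
have E : transition c c' (cmap c p) = cmap c' p by rewrite /transition cmapK.
have T2 : differentiable (transition c' c'') (transition c c' (cmap c p)).
  by rewrite E; exact: differentiable_transition.
have T3 := differentiable_transition ac cp ac'' cp''.
have N : \forall z \near cmap c p, (transition c' c'' \o transition c c') z = transition c c'' z.
  have := near_cmap (cdom_open c') cp' cp; apply: filterS => z [cz [c'z _]].
  by rewrite /transition /= cmapK.
have D : 'D_w (transition c' c'' \o transition c c') (cmap c p) =
         'D_w (transition c c'') (cmap c p) := near_eq_derive w N.
transitivity ('D_w (transition c c'') (cmap c p)); last exact: deriveE.
rewrite -D deriveE; last exact: differentiable_comp.
have /(congr1 (fun h => h w)) := diff_comp T1 T2.
rewrite E; exact: esym.
Qed.

Fact transition_id (c : chart R m M) (w : 'rV[R]_m) : atlas c -> cdom c p ->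
  'd (transition c c) (cmap c p) w = w.
Proof.
move=> ac cp; rewrite -deriveE; last exact: differentiable_transition.
rewrite (@near_eq_derive _ _ _ _ id) ?derive_id//.
by have := near_cmap openT I cp; apply: filterS => z [_ [_]].
Qed.

Definition tangent_frame_val (c : chart R m M) (w : 'rV[R]_m) :
    chart R m M -> 'rV[R]_m := fun c' =>
  if `[< [/\ atlas c, cdom c p, atlas c' & cdom c' p] >]
  then 'd (transition c c') (cmap c p) w else 0.

Fact tangent_frame_subproof c w : tangent_frame_val c w \in tangent_pred p.
Proof.
apply/asboolP; rewrite /tangent_frame_val; split=> [c' nc'|c' c'' ac' cp' ac'' cp''].
  by rewrite asboolF// => -[_ _ ? ?]; exact: nc'.
have [[ac cp]|nc] := pselect (atlas c /\ cdom c p).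
  rewrite (asboolT (And4 ac cp ac' cp')) (asboolT (And4 ac cp ac'' cp'')).
  exact: esym (transitionC w ac cp ac' cp' ac'' cp'').
by rewrite !asboolF ?linear0//; move=> [? ? _ _]; exact: nc.
Qed.
Definition tangent_frame c w : tangent p := Tangent (tangent_frame_subproof c w).

Lemma tangent_frameK c : atlas c -> cdom c p ->
  cancel (tangent_frame c) (tangent_coord c).
Proof.
by move=> ac cp w; rewrite /tangent_coord /= /tangent_frame_val asboolT// transition_id.
Qed.

Lemma tangent_coordK c : atlas c -> cdom c p ->
  cancel (tangent_coord c) (tangent_frame c).
Proof.
move=> ac cp v; apply: val_inj; apply/funext => c' /=; rewrite /tangent_frame_val.
have /asboolP [v0 vT] := tangentP v.
have [[ac' cp']|nc] := pselect (atlas c' /\ cdom c' p).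
  by rewrite asboolT// -vT.
by rewrite asboolF ?v0// => -[_ _ ? ?]; exact: nc.
Qed.

End tangent_space.

Definition tangent_triv (c : chart R m M) (ac : atlas c) :
    trivialization (fun p => tangent p : lmodType R) m :=
  @Trivialization R m M (fun p => tangent p : lmodType R) m (cdom c)
    (fun p => @tangent_coord p c) (fun p => @tangent_frame p c) (cdom_open c)
    (fun p cp => tangent_coordK ac cp) (fun p cp => tangent_frameK ac cp).

Definition tangent_atlas :
    set (trivialization (fun p : M => tangent p : lmodType R) m) :=
  [set t | exists c (ac : atlas c), t = tangent_triv ac].

Fact tangent_atlas_cover (p : M) : exists2 t, tangent_atlas t & tdom t p.
Proof.
have [c ac cp] := atlas_cover p.
by exists (tangent_triv ac) => //; exists c, ac.
Qed.

Fact tangent_atlas_compat t t' : tangent_atlas t -> tangent_atlas t' ->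
  forall i j, msmooth (tdom t `&` tdom t')
    (fun x => tcoord t' x (tframe t x (delta_mx ord0 i)) ord0 j).
Proof.
move=> [c [ac ->]] [c' [ac' ->]] i j /=.
have oI : open (cdom c `&` cdom c') by apply: openI; exact: cdom_open.
apply: (@msmooth_ext _ _ _ _
  (fun x => 'D_(delta_mx ord0 i) (fun z => transition c c' z ord0 j) (cmap c x))) => //.
  move=> x [cx cx']; have d := differentiable_transition ac cx ac' cx'.
  by rewrite -derive_rV// deriveE// /tangent_coord /= /tangent_frame_val asboolT.
move=> b ab k.
apply: (@Ck_comp _ _ _ k _ (cmap c @` (cdom c `&` cdom c'))
  ('D_(delta_mx ord0 i) (fun z => transition c c' z ord0 j))
  (transition b c)).
- exact: cimg_openI.
- by rewrite setIC; exact/cimg_openI/cdom_open.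
- by move=> _ [x [[cx cx'] bx] <-]; rewrite /transition cmapK//; exists x.
- move=> l; apply: (Ck_sub (W := cmap b @` (cdom b `&` cdom c))); last exact: atlas_compat.
  by move=> _ [x [[cx cx'] bx] <-]; exists x.
- have [_ H] := atlas_compat ac ac' j k.+1; exact: H.
Qed.

Definition tangent_bundle : vbundle M m :=
  @VBundle R m M m _ tangent_atlas tangent_atlas_cover tangent_atlas_compat.

End tangent_bundle.

Section vector_fields.
Context {R : realType} {m : nat} {M : manifold R m}.

Definition chart_at (p : M) : chart R m M := s2val (cid2 (atlas_cover p)).

(* Directional derivative of f along v, computed in a chosen chart; it does not
   depend on the chart by tangent_actE. *)
Definition tangent_act (p : M) (v : tangent p) (f : M -> R) : R :=
  'D_(v (chart_at p)) (fun z => f (cinv (chart_at p) z)) (cmap (chart_at p) p).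

Lemma tangent_actE (p : M) (v : tangent p) (f : M -> R) (c : chart R m M) :
  msmooth setT f -> atlas c -> cdom c p ->
  tangent_act v f = 'D_(v c) (fun z => f (cinv c z)) (cmap c p).
Proof.
move=> sf ac cp; rewrite /tangent_act /chart_at; case: cid2 => b ab bp /=.
have /asboolP [_ vT] := tangentP v; rewrite (vT b c)//.
have dT := differentiable_transition ab bp ac cp.
have E : transition b c (cmap b p) = cmap c p by rewrite /transition cmapK.
have df : differentiable (fun z => f (cinv c z)) (transition b c (cmap b p)).
  by rewrite E; have [d _] := sf c ac 1%N; apply: d; exists p.
have := derive_comp_rV (v b) dT df; rewrite E => <-.
apply: near_eq_derive.
have := near_cmap (cdom_open c) cp bp; apply: filterS => z [bz [cz _]].
by rewrite /transition /= cmapK.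
Qed.

Fact vf_act_subproof (X : section (tangent_bundle M)) (f : smooth_fun M) :
  msmooth setT (fun x => tangent_act (X x) f).
Proof.
move=> c ac.
have oc : open (cmap c @` (setT `&` cdom c)) by exact/cimg_openI/openT.
have sf := smooth_fun_msmooth f.
have H k : Ck k (cmap c @` (setT `&` cdom c)) (fun z => \sum_j
    tangent_coord c (X (cinv c z)) ord0 j *
    'D_(delta_mx ord0 j) (fun z => f (cinv c z)) z).
  apply: Ck_sum => // j; apply: CkM => //.
    have := @section_smoothP _ _ _ _ _ X (tangent_triv ac).
    move=> /(_ (ex_intro _ c (ex_intro _ ac erefl)) j c ac k) /=.
    by rewrite -setIA setIid.
  by have [_] := sf c ac k.+1; apply.
move=> k; apply: Ck_ext (H k) => // _ [x [_ cx] <-].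
rewrite cmapK// (tangent_actE _ sf ac cx) derive_sum_delta//.
by have [d _] := sf c ac 1%N; apply: d; exists x.
Qed.

Definition vf_act (X : section (tangent_bundle M)) (f : smooth_fun M) :
  smooth_fun M := mk_smooth_fun (vf_act_subproof X f).

End vector_fields.

Section bundle_maps.
Context {R : realType} {m : nat} {M : manifold R m} {r q : nat}.
Context (E : vbundle M r) (F : vbundle M q).

Definition bundle_map_smooth (h : forall x, {linear E x -> F x}) : Prop :=
  forall t t', vatlas t -> vatlas t' -> forall i j,
    msmooth (tdom t `&` tdom t')
      (fun x => tcoord t' x (h x (frame_vec t i x)) ord0 j).

Record bundle_map := BundleMap {
  bundle_map_val :> forall x, {linear E x -> F x};
  bundle_mapP : bundle_map_smooth bundle_map_val }.

Lemma frame_expand (t : trivialization E r) x (v : E x) : tdom t x ->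
  v = \sum_i tcoord t x v ord0 i *: frame_vec t i x.
Proof.
move=> tx; apply: (can_inj (tcoordK tx)); rewrite linear_sum [LHS]row_sum_delta.
by apply: eq_bigr => i _; rewrite linearZ /frame_vec /= tframeK.
Qed.

Lemma msmooth_vcover (U : set M) (f : M -> R) :
  (forall t : trivialization E r, vatlas t -> msmooth (tdom t `&` U) f) ->
  msmooth U f.
Proof.
move=> H.
apply: (@msmooth_sub _ _ _ U
  (\bigcup_(t : {t : trivialization E r | vatlas t}) (tdom (sval t) `&` U))).
  move=> x Ux; have [t vt tx] := vatlas_cover E x.
  by exists (exist _ t vt).
by apply: msmooth_bigcup => -[t vt]; exact: H.
Qed.

Fact map_section_subproof (h : bundle_map) (s : section E) :
  section_smooth setT (fun x => h x (s x)).
Proof.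
move=> t' vt' j; apply: msmooth_vcover => t vt.
have ot := tdom_open t; have ot' := tdom_open t'.
have oI : open (tdom t `&` (setT `&` tdom t')) by rewrite setTI; exact: openI.
apply: (@msmooth_ext _ _ _ _ (fun x => \sum_i tcoord t x (s x) ord0 i *
  tcoord t' x (h x (frame_vec t i x)) ord0 j)) => //.
  move=> x [tx [_ tx']]; rewrite [in RHS](frame_expand (s x) tx) !linear_sum.
  by rewrite summxE; apply: eq_bigr => i _; rewrite !linearZ mxE.
apply: msmooth_sum => // i; apply: msmoothM => //.
  by apply: msmooth_sub (section_smoothP s vt i) => x [].
by rewrite setTI; exact: bundle_mapP.
Qed.

Definition map_section (h : bundle_map) (s : section E) : section F :=
  Section_ (map_section_subproof h s).

End bundle_maps.

Section alternating_forms.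
Context {R : realType}.

Definition fset_at (k : nat) (T : Type) (e : 'I_k -> T) (i : 'I_k) (v : T) :
  'I_k -> T := fun j => if j == i then v else e j.

Definition fcons (k : nat) (T : Type) (v : T) (e : 'I_k -> T) : 'I_k.+1 -> T :=
  fun i => if unlift ord0 i is Some j then e j else v.

(* Elements of the k-th exterior power of the dual of V, as alternating
   multilinear maps. *)
Definition alt_pred (k : nat) (V : lmodType R) : {pred ('I_k -> V) -> R^o} :=
  fun a => `[<
    (forall e i (c : R) u v, a (fset_at e i (c *: u + v)) =
       c * a (fset_at e i u) + a (fset_at e i v)) /\
    (forall e i j, i != j -> e i = e j -> a e = 0) >].

Record alt (k : nat) (V : lmodType R) := Alt {
  alt_val :> ('I_k -> V) -> R^o;
  alt_valP : alt_val \in @alt_pred k V }.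

Section alt_lmod.
Variables (k : nat) (V : lmodType R).
HB.instance Definition _ := [isSub of alt k V for @alt_val k V].
HB.instance Definition _ := [Choice of alt k V by <:].

Fact alt_submod : submod_closed (@alt_pred k V).
Proof.
split.
  by apply/asboolP; split=> [e i c u v|//]; rewrite mulr0 addr0.
move=> b f g /asboolP [fl fa] /asboolP [gl ga]; apply/asboolP; split.
  move=> e i c u v; rewrite !fctE fl gl !scalerDr.
  by rewrite mulrDr -!addrA; congr (_ + _); [rewrite /GRing.scale/= mulrCA|rewrite addrCA].
by move=> e i j ij eij; rewrite !fctE (fa _ _ _ ij eij) (ga _ _ _ ij eij) scaler0 addr0.
Qed.
HB.instance Definition _ := GRing.isSubmodClosed.Build R
  (('I_k -> V) -> R^o) (@alt_pred k V) alt_submod.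
HB.instance Definition _ := [SubChoice_isSubLmodule of alt k V by <:].
End alt_lmod.

Lemma alt_multilinear k (V : lmodType R) (a : alt k V) e i c u v :
  a (fset_at e i (c *: u + v)) = c * a (fset_at e i u) + a (fset_at e i v).
Proof. by have /asboolP [H _] := alt_valP a. Qed.

Lemma alt_alternating k (V : lmodType R) (a : alt k V) e i j :
  i != j -> e i = e j -> a e = 0.
Proof. by have /asboolP [_] := alt_valP a; apply. Qed.

Fact alt_cons_subproof k (V : lmodType R) (v : V) (a : alt k.+1 V) :
  (fun e => a (fcons v e)) \in @alt_pred k V.
Proof.
have fE (e : 'I_k -> V) i u : fcons v (fset_at e i u) =
    fset_at (fcons v e) (lift ord0 i) u.
  apply/funext => j; rewrite /fcons /fset_at.
  case: unliftP => [j' ->|->]; last by [].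
  by rewrite (inj_eq lift_inj).
apply/asboolP; split=> [e i c u w|e i j ij eij]; first by rewrite !fE alt_multilinear.
apply: (@alt_alternating _ _ a _ (lift ord0 i) (lift ord0 j)).
  by rewrite (inj_eq lift_inj).
by rewrite /fcons !liftK.
Qed.

(* Contraction in the first slot; it vanishes on forms of degree 0, where the
   target degree 0.-1 = 0 is a dummy. *)
Definition alt_iota (V : lmodType R) (v : V) {k : nat} : alt k V -> alt k.-1 V :=
  match k return alt k V -> alt k.-1 V with
  | 0%N => fun=> 0
  | k'.+1 => fun a => Alt (alt_cons_subproof v a)
  end.

End alternating_forms.

Section alt_sum.
Context {R : realType} (k : nat) (V : lmodType R) (a : alt k V).

Lemma alt_set0 e i : a (fset_at e i 0) = 0.
Proof.
have := alt_multilinear a e i 1 0 0; rewrite scaler0 addr0 mul1r.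
by move/eqP; rewrite eq_sym -subr_eq0 addrK => /eqP.
Qed.

Lemma alt_set_sum e i (I : Type) (s : seq I) (c : I -> R) (v : I -> V) :
  a (fset_at e i (\sum_(j <- s) c j *: v j)) =
  \sum_(j <- s) c j * a (fset_at e i (v j)).
Proof.
elim: s => [|j s IH]; first by rewrite !big_nil alt_set0.
by rewrite !big_cons alt_multilinear IH.
Qed.
End alt_sum.

Section forms.
Context {R : realType} {m : nat} {M : manifold R m} {r : nat} (E : vbundle M r).
Implicit Types (U W : set M) (k : nat).

(* Smooth sections of the k-th exterior power of the dual bundle: the components
   in the local frames are smooth. *)
Definition extform_smooth k U (a : forall x, alt k (E x)) : Prop :=
  forall t, vatlas t -> forall J : 'I_k -> 'I_r,
    msmooth (U `&` tdom t) (fun x => a x (fun i => frame_vec t (J i) x)).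

Record extform k := ExtForm {
  extform_val :> forall x, alt k (E x);
  extform_smoothP : extform_smooth setT extform_val }.

Lemma extform_eq k (a b : extform k) : (forall x, a x = b x) -> a = b.
Proof.
case: a b => [a pa] [b pb] /= ab.
have E0 : a = b by exact: functional_extensionality_dep.
by rewrite E0 in pa *; congr ExtForm; exact: Prop_irrelevance.
Qed.

Section extform_zmod.
Variable k : nat.
HB.instance Definition _ := gen_eqMixin (extform k).
HB.instance Definition _ := gen_choiceMixin (extform k).

Fact extform0_subproof : extform_smooth setT (fun x => 0 : alt k (E x)).
Proof. by move=> t at_ J; exact: msmooth_cst. Qed.
Definition extform0 := ExtForm extform0_subproof.

Fact extformD_subproof (a b : extform k) : extform_smooth setT (fun x => a x + b x).
Proof.
move=> t vt J; apply: msmoothD; [exact: openIT (tdom_open t)| |]; exact: extform_smoothP.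
Qed.
Definition extformD a b := ExtForm (extformD_subproof a b).

Fact extformN_subproof (a : extform k) : extform_smooth setT (fun x => - a x).
Proof.
move=> t vt J; apply: msmoothN; [exact: openIT (tdom_open t)|exact: extform_smoothP].
Qed.
Definition extformN a := ExtForm (extformN_subproof a).

Fact extformA : associative extformD.
Proof. by move=> s t u; apply: extform_eq => x /=; rewrite addrA. Qed.
Fact extformC : commutative extformD.
Proof. by move=> s t; apply: extform_eq => x /=; rewrite addrC. Qed.
Fact extform0D : left_id extform0 extformD.
Proof. by move=> s; apply: extform_eq => x /=; rewrite add0r. Qed.
Fact extformND : left_inverse extform0 extformN extformD.
Proof. by move=> s; apply: extform_eq => x /=; rewrite addNr. Qed.
HB.instance Definition _ :=
  GRing.isZmodule.Build (extform k) extformA extformC extform0D extformND.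
End extform_zmod.

Lemma extform_eval_smooth k U W (a : forall x, alt k (E x)) (t : trivialization E r)
    (e : 'I_k -> forall x, E x) :
  open W -> W `<=` U `&` tdom t -> extform_smooth U a -> vatlas t ->
  (forall i j, msmooth W (fun x => tcoord t x (e i x) ord0 j)) ->
  msmooth W (fun x => a x (fun i => e i x)).
Proof.
move=> oW WU sa vt se.
suff H l : (l <= k)%N -> forall e : 'I_k -> forall x, E x,
    (forall i j, msmooth W (fun x => tcoord t x (e i x) ord0 j)) ->
    (forall i : 'I_k, (l <= i)%N -> exists j, e i = frame_vec t j) ->
    msmooth W (fun x => a x (fun i => e i x)).
  by apply: (H k (leqnn k) e se) => i; rewrite leqNgt ltn_ord.
elim: l => [|l IH] lk {}e {}se ef.
  have /choice [J eJ] : forall i, exists j, e i = frame_vec t j by move=> i; exact: ef.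
  apply: (msmooth_ext oW _ (msmooth_sub WU (sa t vt J))) => x _.
  by congr (a x _); apply/funext => i; rewrite eJ.
pose i0 := Ordinal lk.
pose e' j i : forall x, E x := if i == i0 then frame_vec t j else e i.
apply: (@msmooth_ext _ _ _ _ (fun x => \sum_j
   tcoord t x (e i0 x) ord0 j * a x (fun i => e' j i x))) => //.
  move=> x /WU [_ tx].
  have -> : (fun i => e i x) = fset_at (fun i => e i x) i0
      (\sum_j tcoord t x (e i0 x) ord0 j *: frame_vec t j x).
    apply/funext => i; rewrite /fset_at -frame_expand//.
    by case: eqP => [->|].
  rewrite alt_set_sum; apply: eq_bigr => j _; congr (_ * a x _).
  by apply/funext => i; rewrite /e' /fset_at; case: eqP.
apply: msmooth_sum => // j; apply: msmoothM => //.
apply: IH => [|i j'|i li]; first exact: ltnW.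
  rewrite /e'; case: eqP => _; last exact: se.
  apply: (msmooth_ext oW _ (msmooth_cst W ((delta_mx ord0 j : 'rV[R]_r) ord0 j'))).
  by move=> x /WU [_ tx]; rewrite /frame_vec tframeK.
rewrite /e'; case: eqP => [_|/eqP ni]; first by exists j.
by apply: ef; rewrite ltn_neqAle li andbT eq_sym; exact: ni.
Qed.

Fact extform_eval_subproof k (a : extform k) (e : 'I_k -> section E) :
  msmooth setT (fun x => a x (fun i => e i x)).
Proof.
apply: (@msmooth_vcover _ _ _ _ E) => t vt; rewrite setIT.
apply: (extform_eval_smooth (e := fun i => e i : forall x, E x) (tdom_open t) _
  (extform_smoothP a) vt); first by rewrite setTI.
by move=> i j; have := section_smoothP (e i) vt j; rewrite setTI.
Qed.

Definition extform_eval k (a : extform k) (e : 'I_k -> section E) : smooth_fun M :=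
  mk_smooth_fun (extform_eval_subproof a e).

Fact extform_iota_subproof (u : section E) k (a : extform k) :
  extform_smooth setT (fun x => alt_iota (u x) (a x)).
Proof.
case: k a => [|k] a t vt J; first exact: msmooth_cst.
apply: (msmooth_ext _ _ (extform_eval_smooth (W := setT `&` tdom t)
  (e := fcons (u : forall x, E x) (fun i => frame_vec t (J i))) _ _
  (extform_smoothP a) vt _)) => //.
- exact: openIT (tdom_open t).
- move=> x _ /=; congr (a x _); apply/funext => i.
  by rewrite /fcons; case: unlift.
- exact: openIT (tdom_open t).
- move=> i j; rewrite /fcons; case: unliftP => [i' _|_]; last exact: section_smoothP.
  apply: (msmooth_ext _ _ (msmooth_cst _ ((delta_mx ord0 (J i') : 'rV[R]_r) ord0 j))).
    exact: openIT (tdom_open t).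
  by move=> x [_ tx]; rewrite /frame_vec tframeK.
Qed.

Definition extform_iota (u : section E) k (a : extform k) : extform k.-1 :=
  ExtForm (extform_iota_subproof u a).

End forms.

(* The formula for the differential of a form is in terms of its values on global
   sections, so the operators below act on the functions of k sections;
   extform_eval maps a section of the k-th exterior power to such a function. *)
Definition cochain (R : realType) (m : nat) (M : manifold R m) (r : nat)
    (E : vbundle M r) (k : nat) : Type := ('I_k -> section E) -> smooth_fun M.
HB.instance Definition _ (R : realType) (m : nat) (M : manifold R m) (r : nat)
    (E : vbundle M r) (k : nat) :=
  GRing.Zmodule.copy (cochain E k) (('I_k -> section E) -> smooth_fun M).

Section lie_algebroids.
Context {R : realType} {m : nat} (M : manifold R m) (r : nat).

Record lie_algebroid := LieAlgebroid {
  la_bundle :> vbundle M r;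
  la_anchor : bundle_map la_bundle (tangent_bundle M);
  la_bracket : section la_bundle -> section la_bundle -> section la_bundle;
  la_bracket_linearl : forall (a : R) u v w,
    la_bracket (cst_fun M a *: u + v) w =
      cst_fun M a *: la_bracket u w + la_bracket v w;
  la_bracket_linearr : forall (a : R) u v w,
    la_bracket u (cst_fun M a *: v + w) =
      cst_fun M a *: la_bracket u v + la_bracket u w;
  la_bracketC : forall u v, la_bracket u v = - la_bracket v u;
  la_jacobi : forall u v w,
    la_bracket u (la_bracket v w) + la_bracket v (la_bracket w u) +
    la_bracket w (la_bracket u v) = 0;
  la_leibniz : forall u v (f : smooth_fun M),
    la_bracket u (f *: v) =
      f *: la_bracket u v + vf_act (map_section la_anchor u) f *: v }.

Variable A : lie_algebroid.

Definition anchor_act (u : section A) (f : smooth_fun M) : smooth_fun M :=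
  vf_act (map_section (la_anchor A) u) f.

(* Indices start from 0, so that (-1)^(i-1) becomes (-1)^i while (-1)^(i+j) is
   unchanged; b |-> bump j (bump i b) enumerates the indices other than i < j. *)
Definition lie_d {k} (c : cochain A k) : cochain A k.+1 := fun e =>
  \sum_(i < k.+1) (-1) ^+ i * anchor_act (e i) (c (fun a => e (lift i a))) +
  \sum_(i < k.+1) \sum_(j < k.+1 | (i < j)%N) (-1) ^+ (i + j) *
     c (fun a => if val a is b.+1 then e (inord (bump j (bump i b)))
                 else la_bracket (e i) (e j)).

Definition contract (u : section A) {k} : cochain A k -> cochain A k.-1 :=
  match k return cochain A k -> cochain A k.-1 with
  | 0%N => fun=> 0
  | k'.+1 => fun c e => c (fcons u e)
  end.

Definition lie_derivative (u : section A) {k} : cochain A k -> cochain A k :=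
  match k return cochain A k -> cochain A k with
  | 0%N => fun c => contract u (lie_d c)
  | k'.+1 => fun c => contract u (lie_d c) + lie_d (contract u c)
  end.

(* w(rho(e_k), ..., rho(e_1)), with the order of the arguments reversed. *)
Definition iota_anchor {k} (w : extform (tangent_bundle M) k) : cochain A k :=
  fun e => extform_eval w (fun i => map_section (la_anchor A) (e (rev_ord i))).

End lie_algebroids.
Arguments iota_anchor {R m M r} A {k} w.

Section higher_dirac.
Context {R : realType} {m : nat} {M : manifold R m} {r : nat}.
Variables (A : lie_algebroid M r) (n : nat).

(* Sections of E (+) /\^(n-1) E^*. *)
Definition lsection : Type := (section A * extform A n.-1)%type.

(* For n = 1 both terms are contractions of forms of degree 0, hence the pairing
   is zero. *)
Definition pairing (s t : lsection) : extform A n.-1.-1 :=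
  extform_iota s.1 t.2 + extform_iota t.1 s.2.

Definition dorfman (w : extform (tangent_bundle M) n.+1) (s t : lsection) :
    section A * cochain A n.-1 :=
  (la_bracket s.1 t.1,
   lie_derivative s.1 (extform_eval t.2) - contract t.1 (lie_d (extform_eval s.2)) +
   contract t.1 (contract s.1 (iota_anchor A w))).

(* A subset of each fibre of E (+) /\^(n-1) E^*. *)
Definition lsubset := forall x : M, set (A x * alt n.-1 (A x)).

(* Around each point L has a smooth local frame, with a constant number q of
   elements. *)
Definition subbundle (L : lsubset) : Prop := exists q : nat,
  forall p : M, exists U : set M, [/\ open U, U p &
    exists (u : 'I_q -> forall x, A x) (a : 'I_q -> forall x, alt n.-1 (A x)),
    [/\ (forall i, section_smooth U (u i)), (forall i, extform_smooth U (a i)) &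
      forall x, U x ->
        L x = range (fun c : 'I_q -> R => \sum_i c i *: (u i x, a i x)) /\
        injective (fun c : 'I_q -> R => \sum_i c i *: (u i x, a i x))]].

Definition sections_of (L : lsubset) : set lsection :=
  [set s : lsection | forall x, L x (s.1 x, s.2 x)].

(* The last clause says that the Dorfman bracket, a pair whose second component is
   given by its values on sections, comes from a section of L. *)
Definition higher_dirac (w : extform (tangent_bundle M) n.+1) (L : lsubset) : Prop :=
  [/\ subbundle L,
      (forall s t, sections_of L s -> sections_of L t -> pairing s t = 0) &
      (forall s t, sections_of L s -> sections_of L t ->
         exists2 z, sections_of L z & dorfman w s t = (z.1, extform_eval z.2))].

End higher_dirac.

(* The fibre at x is {v + iota_v J_x | v in E_x}. *)
Definition graph (R : realType) (m : nat) (M : manifold R m) (r : nat)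
    (A : lie_algebroid M r) (n : nat) (J : extform A n) : lsubset A n :=
  fun x => [set va | va.2 = alt_iota va.1 (J x)].

(* Main.v *)
Require Import Defs.
From mathcomp Require Import all_boot all_order all_algebra.
From mathcomp Require Import perm.
From mathcomp Require Import all_classical all_reals all_analysis.
Import GRing.Theory.
Local Open Scope ring_scope.

(** The theorem says that the graph of J is closed under the twisted Dorfman
    bracket because dJ cancels the twist. For the sections u + iota_u J and
    v + iota_v J, the twist iota_v iota_u (iota_rho w) equals
    - iota_v iota_u dJ, and Cartan's formula L_u = iota_u d + d iota_u turns the
    second component of the bracket into L_u iota_v J - iota_v L_u J. The commutation rule [L_u, iota_v] = iota_[u,v]
    ([lie_derivative_contract]) identifies this with iota_[u,v] J, which is what
    the graph prescribes over [u, v] ([dorfman_graph]).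

    The commutation rule is immediate from the explicit formula
    (L_u c)(e) = rho(u) c(e) - sum_i c(e_1, .., [u, e_i], .., e_k)
    ([lie_derivativeE]). To get it, the terms of d c (u, e) in which u remains an
    argument of c are cancelled by d (iota_u c) (e); the others are
    rho(u) c(e) and terms c([u, e_i], ..) that an antisymmetric c carries back to the slot of e_i with a sign. The
    argument takes place among cochains, where d is defined by its formula, and
    applies to J because a form evaluated on sections is an antisymmetric cochain
    ([extform_eval_swap_antisymmetric]).

    Isotropy of the graph is the antisymmetry of J in its first two slots. The
    graph is a subbundle because a local frame e_i of E yields the local frame
    e_i + iota_(e_i) J of it. *)

(** * Antisymmetric functions of several arguments *)

Section antisymmetric.
Context {T : Type} {V : pzRingType}.

(** Stated for functions on an arbitrary type, so that it covers both forms on one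
    fibre and cochains, whose arguments are global sections. *)
Definition swap_antisymmetric {k : nat} (c : ('I_k -> T) -> V) : Prop :=
  forall (e : 'I_k -> T) i j, i != j -> c (fun a => e (tperm i j a)) = - c e.

Lemma fcons0 k (v : T) (e : 'I_k -> T) : fcons v e ord0 = v.
Proof. by rewrite /fcons unlift_none. Qed.

Lemma fcons_lift k (v : T) (e : 'I_k -> T) i : fcons v e (lift ord0 i) = e i.
Proof. by rewrite /fcons liftK. Qed.

Lemma fcons_eq {k} (v : T) (e : 'I_k -> T) (f : 'I_k.+1 -> T) :
  f ord0 = v -> (forall i, f (lift ord0 i) = e i) -> f = fcons v e.
Proof.
move=> f0 fS; apply/funext => a; case: (unliftP ord0 a) => [i ->|->].
  by rewrite fcons_lift.
by rewrite fcons0.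
Qed.

Lemma swap_antisymmetric_fcons k (c : ('I_k.+1 -> T) -> V) (v : T) :
  swap_antisymmetric c -> swap_antisymmetric (fun e => c (fcons v e)).
Proof.
move=> ac e i j ij.
rewrite -(ac _ (lift ord0 i) (lift ord0 j)) ?(inj_eq lift_inj)//.
congr c; apply/esym/fcons_eq => [|a].
  by rewrite tpermD ?fcons0 // eq_sym neq_lift.
by rewrite -(inj_tperm _ _ _ (@lift_inj _ ord0)) fcons_lift.
Qed.

Lemma swap_antisymmetric_front2 k (c : ('I_k.+2 -> T) -> V) (v w : T) e :
  swap_antisymmetric c -> c (fcons v (fcons w e)) = - c (fcons w (fcons v e)).
Proof.
move=> ac; rewrite -(ac _ ord0 (lift ord0 ord0))//; congr c.
apply/esym/fcons_eq => [|a]; first by rewrite tpermL fcons_lift fcons0.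
case: (unliftP ord0 a) => [b ->|->].
  by rewrite tpermD ?neq_lift ?(inj_eq lift_inj) ?neq_lift// !fcons_lift.
by rewrite tpermR !fcons0.
Qed.

(** The j-th argument reaches the front after passing the j earlier ones. The
    induction fixes the first argument and moves w to the second slot; one more
    exchange then brings it to the front. *)
Lemma swap_antisymmetric_front k (c : ('I_k.+1 -> T) -> V) (e : 'I_k.+1 -> T) j w :
  swap_antisymmetric c ->
  c (fcons w (fun a => e (lift j a))) = (-1) ^+ j * c (fset_at e j w).
Proof.
elim: k c e j => [|k IH] c e j ac.
  rewrite (ord1 j) expr0 mul1r; congr c; apply/esym/fcons_eq => [|[]//].
  by rewrite /fset_at eqxx.
case: (unliftP ord0 j) => [i ->|->]; last first.
  rewrite expr0 mul1r; congr c; apply/esym/fcons_eq => [|a].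
    by rewrite /fset_at eqxx.
  by rewrite /fset_at eq_sym (negbTE (neq_lift _ _)).
have -> : (fun a => e (lift (lift ord0 i) a)) =
    fcons (e ord0) (fun a => e (lift ord0 (lift i a))).
  apply: fcons_eq => [|a]; congr e; apply: val_inj => //=.
  by rewrite /bump /= !add1n ltnS addnS.
rewrite swap_antisymmetric_front2//.
have := IH _ (fun a => e (lift ord0 a)) i (swap_antisymmetric_fcons _ _ (e ord0) ac).
rewrite /= => ->.
rewrite /bump /= add1n exprS mulN1r mulNr; congr (- (_ * c _)).
apply/esym/fcons_eq => [|a]; first by rewrite /fset_at (negbTE (neq_lift _ _)).
by rewrite /fset_at (inj_eq lift_inj).
Qed.

End antisymmetric.

(** * Contractions of alternating forms *)

Section alternating.
Context {R : realType} {V : lmodType R}.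

(** Polarization: expand a(.., x + y, .., x + y, ..) = 0, where x and y are the
    arguments in the slots i and j. *)
Lemma alt_swap_antisymmetric k (a : alt k V) :
  swap_antisymmetric (a : _ -> R).
Proof.
move=> e i j ij; have ji : j != i by rewrite eq_sym.
pose f x y := a (fset_at (fset_at e i x) j y).
have fD2 x y z : f x (y + z) = f x y + f x z.
  by rewrite /f -[y]scale1r alt_multilinear mul1r scale1r.
have fC x y : f x y = a (fset_at (fset_at e j y) i x).
  rewrite /f; congr (a _); apply/funext => b; rewrite /fset_at.
  by case: eqP => [->|//]; rewrite (negbTE ji).
have fD1 x y z : f (x + y) z = f x z + f y z.
  by rewrite !fC -[x]scale1r alt_multilinear mul1r scale1r.
have f0 x : f x x = 0.
  apply: (@alt_alternating _ _ _ a _ i j) => //.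
  by rewrite /fset_at eqxx (negbTE ij) eqxx.
have := f0 (e i + e j); rewrite fD1 !fD2 !f0 add0r addr0 => /eqP.
rewrite addrC addr_eq0 => /eqP; rewrite /f => H.
transitivity (a (fset_at (fset_at e i (e j)) j (e i))).
  congr (a _); apply/funext => b; rewrite /fset_at.
  case: tpermP => [->|->|]; rewrite ?eqxx ?(negbTE ij)//.
  by move=> /eqP/negbTE -> /eqP/negbTE ->.
rewrite H; congr (- a _); apply/funext => b; rewrite /fset_at.
by case: eqP => [->//|]; case: eqP => [->|].
Qed.

Lemma alt_iotaC {k} (a : alt k V) (u v : V) :
  alt_iota u (alt_iota v a) + alt_iota v (alt_iota u a) = 0.
Proof.
case: k a => [|[|k]] a; try by rewrite /= addr0.
apply: val_inj; apply/funext => e /=.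
have H := swap_antisymmetric_front2 _ _ v u e (@alt_swap_antisymmetric _ a).
by rewrite /GRing.add /= H addNr.
Qed.

Lemma alt_iota_linear k (a : alt k V) : linear (fun v : V => alt_iota v a).
Proof.
case: k a => [|k] a b u v; first by rewrite /= scaler0 addr0.
apply: val_inj; apply/funext => e /=.
have E x : fcons x e = fset_at (fcons 0 e) ord0 x.
  apply/esym/fcons_eq => [|i]; first by rewrite /fset_at eqxx.
  by rewrite /fset_at eq_sym (negbTE (neq_lift _ _)) fcons_lift.
by rewrite E alt_multilinear -!E.
Qed.

Lemma alt_iota_sum k (a : alt k V) (I : Type) (s : seq I) (c : I -> R) (v : I -> V) :
  alt_iota (\sum_(i <- s) c i *: v i) a = \sum_(i <- s) c i *: alt_iota (v i) a.
Proof.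
have iota0 : alt_iota 0 a = 0.
  by have := alt_iota_linear _ a (-1) 0 0; rewrite scaler0 addr0 scaleN1r addNr.
by elim/big_rec2: _ => // i _ b _ <-; exact: alt_iota_linear.
Qed.

End alternating.

(** * Cartan calculus on cochains *)

Lemma sum_ord_gt0 {V : zmodType} k (F : 'I_k.+1 -> V) :
  \sum_(j < k.+1 | ((ord0 : 'I_k.+1) < j)%N) F j = \sum_(j < k) F (lift ord0 j).
Proof. by rewrite big_mkcond big_ord_recl; exact: add0r. Qed.

Lemma sum_ord_gt_lift {V : zmodType} k (i : 'I_k) (F : 'I_k.+1 -> V) :
  \sum_(j < k.+1 | (lift ord0 i < j)%N) F j =
  \sum_(j < k | (i < j)%N) F (lift ord0 j).
Proof.
rewrite [LHS]big_mkcond big_ord_recl [RHS]big_mkcond; apply: etrans (add0r _) _.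
by apply: eq_bigr.
Qed.

Section cartan.
Context {R : realType} {m : nat} {M : manifold R m} {r : nat}.
Variable A : lie_algebroid M r.

(** The anchor terms of d c (u, e): the first one differentiates along u, and
    removing the slot of u shifts the remaining signs by one. The sum that is
    subtracted is the anchor part of d (iota_u c) (e). *)
Lemma lie_d_fcons_anchor k (c : cochain A k.+1) (u : section A) e :
  \sum_(i < k.+2) (-1) ^+ i *
    anchor_act (fcons u e i) (c (fun a => fcons u e (lift i a))) =
  anchor_act u (c e) - \sum_(i < k.+1) (-1) ^+ i *
    anchor_act (e i) (Defs.contract u c (fun a => e (lift i a))).
Proof.
rewrite big_ord_recl expr0 mul1r fcons0.
have -> : (fun a => fcons u e (lift ord0 a)) = e.
  by apply/funext => a; rewrite fcons_lift.
congr (_ + _); rewrite -sumrN; apply: eq_bigr => i _.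
rewrite fcons_lift exprS mulN1r mulNr; congr (- (_ * anchor_act _ (c _))).
apply: fcons_eq => [|a].
  have -> : lift (lift ord0 i) ord0 = ord0 by exact: val_inj.
  exact: fcons0.
have -> : lift (lift ord0 i) (lift ord0 a) = lift ord0 (lift i a).
  by apply: val_inj; rewrite /= /bump /= !add1n ltnS addnS.
by rewrite fcons_lift.
Qed.

(** The bracket terms of d c (u, e). Those with i = 0 contain [u, e_j], which
    returns to slot j by [swap_antisymmetric_front]; the two signs combine to -1.
    In the others u stands behind [e_i, e_j], and exchanging the two gives the
    bracket part of d (iota_u c) (e) with the opposite sign. *)
Lemma lie_d_fcons_bracket k (c : cochain A k.+1) (u : section A) e :
  swap_antisymmetric c ->
  \sum_(i < k.+2) \sum_(j < k.+2 | (i < j)%N) (-1) ^+ (i + j) *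
     c (fun a => if val a is b.+1 then fcons u e (inord (bump j (bump i b)))
                 else la_bracket (fcons u e i) (fcons u e j)) =
  - \sum_(i < k.+1) c (fset_at e i (la_bracket u (e i))) -
  \sum_(i < k.+1) \sum_(j < k.+1 | (i < j)%N) (-1) ^+ (i + j) *
     Defs.contract u c
       (fun a => if val a is b.+1 then e (inord (bump j (bump i b)))
                 else la_bracket (e i) (e j)).
Proof.
move=> ac; rewrite big_ord_recl -!sumrN; congr (_ + _).
  rewrite sum_ord_gt0; apply: eq_bigr => j _.
  rewrite [LHS]/= add0n fcons0 fcons_lift.
  rewrite [X in c X](_ : _ = fcons (la_bracket u (e j)) (fun a => e (lift j a))).
    rewrite swap_antisymmetric_front// mulrA -exprD addSn exprS -signr_odd.
    by rewrite oddD addbb expr0 mulr1 mulN1r.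
  apply: fcons_eq => // a /=; rewrite -(fcons_lift _ u e); congr (fcons u e).
  have E : bump (lift ord0 j) (bump 0 a) = lift ord0 (lift j a).
    by rewrite /bump /= !add1n ltnS addnS.
  by apply: val_inj; rewrite /= -[X in _ = X]E inordK// E.
apply: eq_bigr => i _.
rewrite sum_ord_gt_lift -sumrN; apply: eq_bigr => j ij.
rewrite [LHS]/=.
rewrite /bump /= !add1n addSn addnS !exprS !mulN1r opprK -mulrN; congr (_ * _).
rewrite !fcons_lift.
(* A pair i < j requires at least two arguments besides u, hence a second slot
   of c that receives u. *)
case: k c e ac i j ij => [|k] c e ac i j ij; first by rewrite !ord1 in ij.
pose f a := e (inord (bump j (bump i (val (a : 'I_k))))).
transitivity (c (fcons (la_bracket (e i) (e j)) (fcons u f))).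
  congr c; apply: fcons_eq => // a; case: (unliftP ord0 a) => [b ->|->]; last first.
    rewrite fcons0 /= -[RHS](fcons0 _ u e); congr (fcons u e); apply: val_inj.
    by rewrite /= inordK.
  have bb : (bump j (bump i b) < k.+2)%N.
    have le_bump h x : (bump h x <= x.+1)%N by rewrite /bump; case: (h <= x)%N.
    apply: leq_ltn_trans (le_bump _ _) _; rewrite ltnS.
    by apply: leq_ltn_trans (le_bump _ _) _; rewrite ltnS.
  have E : (bump j.+1 (bump i.+1 (bump 0 b)) = (bump j (bump i b)).+1)%N.
    by rewrite /bump /= !add1n ltnS addnS ltnS addnS.
  transitivity (fcons u e (inord (bump j.+1 (bump i.+1 (bump 0 b))))); first by [].
  rewrite fcons_lift /f -[RHS](fcons_lift _ u e); congr (fcons u e).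
  by apply: val_inj; rewrite E /= !inordK.
rewrite swap_antisymmetric_front2//; congr (- c _); apply: fcons_eq; first exact: fcons0.
by move=> a; case: (unliftP ord0 a) => [b ->|->]; rewrite !fcons_lift ?fcons0.
Qed.

(** The classical derivation formula for the Lie derivative. In degree 0 it
    reduces to L_u c = rho(u) c, where d c (u) has no bracket term. *)
Lemma lie_derivativeE k (c : cochain A k) (u : section A) e :
  swap_antisymmetric c ->
  lie_derivative u c e = anchor_act u (c e) -
    \sum_(i < k) c (fset_at e i (la_bracket u (e i))).
Proof.
case: k c e => [|k] c e ac.
  rewrite /= big_ord0 subr0 /lie_d !big_ord1 big_ord1_cond /= addr0 expr0 mul1r.
  by rewrite fcons0; congr (anchor_act u (c _)); apply/funext => -[].
have -> : lie_derivative u c e =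
  lie_d c (fcons u e) + lie_d (Defs.contract u c) e by [].
rewrite /lie_d lie_d_fcons_anchor lie_d_fcons_bracket//.
rewrite -!addrA; congr (_ + _); rewrite addrCA -[RHS]addr0; congr (_ + _).
by rewrite addrA -opprD addNr.
Qed.

(** In [lie_derivativeE] for L_u c (v, e), the term of the slot of v is
    c([u, v], e), and all the other terms form L_u (iota_v c) (e). *)
Lemma lie_derivative_contract k (c : cochain A k.+1) (u v : section A) :
  swap_antisymmetric c ->
  lie_derivative u (Defs.contract v c) =
    Defs.contract v (lie_derivative u c) + Defs.contract (la_bracket u v) c.
Proof.
move=> ac; apply/funext => e.
have av : swap_antisymmetric (Defs.contract v c) by exact: swap_antisymmetric_fcons.
have -> : (Defs.contract v (lie_derivative u c) + Defs.contract (la_bracket u v) c) e =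
  lie_derivative u c (fcons v e) + c (fcons (la_bracket u v) e) by [].
rewrite !lie_derivativeE// -addrA; congr (_ + _).
rewrite big_ord_recl opprD addrAC fcons0.
have -> : fset_at (fcons v e) ord0 (la_bracket u v) = fcons (la_bracket u v) e.
  apply: fcons_eq => [|a]; rewrite /fset_at ?eqxx//.
  by rewrite eq_sym (negbTE (neq_lift _ _)) fcons_lift.
rewrite addNr add0r; congr (- _); apply: eq_bigr => i _; congr (c _).
apply/esym/fcons_eq => [|a]; first by rewrite /fset_at (negbTE (neq_lift _ _)) fcons0.
by rewrite /fset_at (inj_eq lift_inj) !fcons_lift.
Qed.

End cartan.

(** * Forms on a vector bundle *)

Section bundle_forms.
Context {R : realType} {m : nat} {M : manifold R m} {r : nat}.
Variable E : vbundle M r.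

Lemma extform_eval_swap_antisymmetric k (a : extform E k) :
  swap_antisymmetric (extform_eval a).
Proof.
move=> e i j ij; apply: val_inj; apply/funext => x.
exact: (@alt_swap_antisymmetric _ _ _ (a x) (fun b => e b x) i j ij).
Qed.

Lemma fcons_section k (u : section E) (e : 'I_k -> section E) x :
  (fun i => fcons u e i x) = fcons (u x) (fun i => e i x).
Proof. by apply: fcons_eq => [|i]; rewrite ?fcons0 ?fcons_lift. Qed.

Lemma section_smooth_frame (t : trivialization E r) i :
  vatlas t -> section_smooth (tdom t) (frame_vec t i).
Proof. by move=> vt t' vt' j; exact: vatlas_compat. Qed.

(** Contraction with a section over an open set only: local frames do not extend
    to global sections as they stand, so this is what the frame of the graph
    needs. *)
Lemma extform_smooth_iota U (u : forall x, E x) k (a : forall x, alt k (E x)) :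
  open U -> section_smooth U u -> extform_smooth U a ->
  extform_smooth U (fun x => alt_iota (u x) (a x)).
Proof.
case: k a => [|k] a oU su sa t vt I; first exact: msmooth_cst.
have oW : open (U `&` tdom t)%classic by apply: openI => //; exact: tdom_open.
pose e := fcons (u : forall x, E x) (fun i => frame_vec t (I i)).
have eE x : (fun i => e i x) = fcons (u x) (fun i => frame_vec t (I i) x).
  by apply: fcons_eq => [|i]; rewrite /e ?fcons0 ?fcons_lift.
apply: (@msmooth_ext _ _ _ _ (fun x => a x (fun i => e i x))) => //.
  by move=> x _; rewrite eE.
apply: (extform_eval_smooth oW _ sa vt) => // i j.
case: (unliftP ord0 i) => [i' ->|->]; rewrite /e ?fcons0 ?fcons_lift.
  by apply: msmooth_sub (section_smooth_frame t (I i') vt t vt j) => x [].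
exact: su.
Qed.

End bundle_forms.

(** * The graph of a form *)

Section graph.
Context {R : realType} {m : nat} {M : manifold R m} {r : nat}.
Variable A : lie_algebroid M r.

Lemma extform_eval_iota k (u : section A) (a : extform A k) :
  extform_eval (extform_iota u a) = Defs.contract u (extform_eval a) :> cochain A _.
Proof.
case: k a => [|k] a; apply/funext => e; apply: val_inj; apply/funext => x //=.
by rewrite fcons_section.
Qed.

Lemma sections_of_graph n (J : extform A n) (s : lsection A n) :
  sections_of (graph J) s <-> exists u : section A, s = (u, extform_iota u J).
Proof.
split=> [sJ|[u ->] //].
by exists s.1; case: s sJ => u a sJ; congr pair; apply: extform_eq; exact: sJ.
Qed.

(** The map v |-> v + iota_v J is a linear isomorphism from E onto the graph with
    inverse the first projection, so it carries local frames to local frames. *)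
Lemma subbundle_graph n (J : extform A n) : subbundle (graph J).
Proof.
exists r => p; have [t vt tp] := vatlas_cover A p.
exists (tdom t); split=> //; first exact: tdom_open.
exists (frame_vec t), (fun i x => alt_iota (frame_vec t i x) (J x)); split.
- by move=> i; exact: section_smooth_frame.
- move=> i; apply: extform_smooth_iota; first exact: tdom_open.
    exact: section_smooth_frame.
  move=> t' vt' I.
  by apply: msmooth_sub (extform_smoothP J vt' I) => x [].
move=> x tx.
have sumE (c : 'I_r -> R) : \sum_i c i *: (frame_vec t i x, alt_iota (frame_vec t i x) (J x)) =
    (\sum_i c i *: frame_vec t i x, alt_iota (\sum_i c i *: frame_vec t i x) (J x)).
  rewrite alt_iota_sum.
  by elim/big_rec3: _ => // i a b c0 _ ->.
split.
  apply/seteqP; split=> [[v a] /= va|_ [c _ <-]]; last by rewrite sumE.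
  exists (fun i => tcoord t x v ord0 i) => //.
  by rewrite sumE -frame_expand//; congr pair.
move=> c d; rewrite !sumE => -[cd _].
have coord (c' : 'I_r -> R) i : tcoord t x (\sum_j c' j *: frame_vec t j x) ord0 i = c' i.
  rewrite linear_sum summxE (bigD1 i)//= big1 ?addr0.
    by rewrite linearZ /frame_vec tframeK// !mxE !eqxx mulr1.
  move=> j ji; rewrite linearZ /frame_vec /= tframeK// !mxE eqxx /=.
  by rewrite eq_sym (negbTE ji) mulr0.
by apply/funext => i; rewrite -(coord c) cd coord.
Qed.

Lemma pairing_graph n (J : extform A n) (u v : section A) :
  pairing (u, extform_iota u J) (v, extform_iota v J) = 0.
Proof. by apply: extform_eq => x; exact: alt_iotaC. Qed.

(** After the twist is replaced by - iota_v iota_u dJ, both terms of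
    iota_v L_u J cancel and the commutation rule leaves iota_[u,v] J. *)
Lemma dorfman_graph n (J : extform A n.+1) (w : extform (tangent_bundle M) n.+2)
    (u v : section A) :
  lie_d (extform_eval J) = - iota_anchor A w ->
  dorfman w (u, extform_iota u J) (v, extform_iota v J) =
    (la_bracket u v, extform_eval (extform_iota (la_bracket u v) J)).
Proof.
move=> dJ; congr pair.
pose c : cochain A n.+1 := extform_eval J.
have ac : swap_antisymmetric c by exact: extform_eval_swap_antisymmetric.
have iotaE x : extform_eval (extform_iota x J) = Defs.contract x c.
  exact: extform_eval_iota.
rewrite [fst _]/= [snd _]/= !iotaE.
change (lie_derivative u (Defs.contract v c) -
  Defs.contract v (lie_d (Defs.contract u c)) +
  Defs.contract v (Defs.contract u (iota_anchor A w)) =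
  Defs.contract (la_bracket u v) c).
rewrite lie_derivative_contract//.
have -> : iota_anchor A w = - lie_d c by rewrite dJ opprK.
apply/funext => e.
change (lie_d c (fcons u (fcons v e)) +
    lie_d (Defs.contract u c) (fcons v e) + Defs.contract (la_bracket u v) c e -
  lie_d (Defs.contract u c) (fcons v e) - lie_d c (fcons u (fcons v e)) =
  Defs.contract (la_bracket u v) c e).
rewrite addrAC [X in X - _]addrAC [X in X + _ - _]addrAC subrr add0r.
by rewrite addrAC subrr add0r.
Qed.

End graph.

Theorem theorem5p2 (R : realType) (m : nat) (M : manifold R m) (r : nat)
    (A : lie_algebroid M r) (n : nat) (n_ge1 : (1 <= n)%N)
    (J : extform A n) (w : extform (tangent_bundle M) n.+1)
    (dJ : lie_d (extform_eval J) = - iota_anchor A w) :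
  (forall s : lsection A n,
     sections_of (graph J) s <-> exists u : section A, s = (u, extform_iota u J)) /\
  higher_dirac w (graph J).
Proof.
split; first exact: sections_of_graph.
split; first exact: subbundle_graph.
  move=> _ _ /sections_of_graph[u ->] /sections_of_graph[v ->].
  exact: pairing_graph.
move=> _ _ /sections_of_graph[u ->] /sections_of_graph[v ->].
exists (la_bracket u v, extform_iota (la_bracket u v) J).
  by apply/sections_of_graph; exists (la_bracket u v).
by case: n n_ge1 J w dJ => // n _ J w; exact: dorfman_graph.
Qed.
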